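(* Let $B$ be a unital $\mathrm{C}^*$-algebra and let $\{\beta_i\}_{i=1}^m$, $\{\beta'_j\}_{j=1}^n$ be families of $*$-epimorphisms of $B$ (onto $B$), with $m\ge n$. Let $[b_{ij}]\in M_{m,n}(B)$ satisfy $\beta_i(b)b_{ij}=b_{ij}\beta'_j(b)$ for all $b\in B$, $1\le i\le m$, $1\le j\le n$. (i) If $[b_{ij}]$ is right invertible, then $m=n$ and $[b_{ij}]$ is invertible in $M_n(B)$. (ii) If $[b_{ij}]$ is right invertible and $B$ has trivial center, then there exist invertible $E,F\in M_n(B)$ such that $E[b_{ij}]F$ is a diagonal matrix $[d_{ij}]$ satisfying $\beta_i(b)d_{ii}=d_{ii}\beta'_{\pi(i)}(b)$ for all $b\in B$ and $1\le i\le n$, for some permutation $\pi\in S_n$.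
   Context: A matrix $[b_{ij}]\in M_{m,n}(B)$ is right invertible if there is $[d_{ij}]\in M_{n,m}(B)$ with $[b_{ij}][d_{ij}]=I_m$. Quasisimilarity here means $E[b_{ij}]F$ is the stated matrix for some invertible matrices $E,F$ over $B$. *)

(* Defs.v *)
From HB Require Import structures.
From mathcomp Require Import all_boot all_order all_algebra all_fingroup.
From mathcomp Require Import complex.
From mathcomp Require Import reals.
Set Implicit Arguments. Unset Strict Implicit. Unset Printing Implicit Defensive.
Import Order.TTheory GRing.Theory Num.Theory.
Local Open Scope ring_scope.

Definition cmod (R : realType) (z : R[i]) : R :=
  Num.sqrt (complex.Re z ^+ 2 + complex.Im z ^+ 2).

Definition is_unital_cstar (R : realType) (A : algType R[i])
  (star : A -> A) (nrm : A -> R) : Prop :=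
  (
      (forall a, star (star a) = a) /\
      (forall a b, star (a + b) = star a + star b) /\
      (forall (c : R[i]) a, star (c *: a) = (conjc c) *: star a) /\
      (forall a b, star (a * b) = star b * star a)) /\ (
      (forall a, 0 <= nrm a) /\ (forall a, nrm a = 0 -> a = 0) /\
      (forall a b, nrm (a + b) <= nrm a + nrm b) /\
      (forall (c : R[i]) a, nrm (c *: a) = cmod c * nrm a) /\
      (forall a b, nrm (a * b) <= nrm a * nrm b) /\
      (forall a, nrm (star a * a) = nrm a ^+ 2)) /\ (
      (forall u : nat -> A,
        (forall e : R, 0 < e -> exists N : nat, forall p q : nat,
            (N <= p)%N -> (N <= q)%N -> nrm (u p - u q) < e) ->
        exists l : A, forall e : R, 0 < e -> exists N : nat, forall p : nat,
            (N <= p)%N -> nrm (u p - l) < e)).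

Definition star_epi (R : realType) (A : algType R[i]) (star : A -> A)
  (f : A -> A) : Prop :=
  [/\ (forall a b, f (a + b) = f a + f b),
      (forall (c : R[i]) a, f (c *: a) = c *: f a),
      (forall a b, f (a * b) = f a * f b),
      (forall a, f (star a) = star (f a)) &
      (forall b, exists a, f a = b)].

Definition trivial_center (R : realType) (A : algType R[i]) : Prop :=
  forall z : A, (forall x : A, z * x = x * z) -> exists c : R[i], z = c%:A.

Definition right_invertible (B : pzRingType) m n (M : 'M[B]_(m, n)) : Prop :=
  exists D : 'M[B]_(n, m), M *m D = 1%:M.

Definition invertible_mx (B : pzRingType) n (M : 'M[B]_n) : Prop :=
  exists D : 'M[B]_n, M *m D = 1%:M /\ D *m M = 1%:M.

(* Main.v *)
Require Import Defs.
From HB Require Import structures.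
From mathcomp Require Import all_boot all_order all_algebra all_fingroup.
From mathcomp Require Import complex.
From mathcomp Require Import reals.
Import Order.TTheory GRing.Theory Num.Theory.
Local Open Scope ring_scope.

(** For an intertwiner [x], with [f b * x = x * g b], the elements [x^* x] and
    [x x^*] are central, because [f] and [g] are onto and preserve the
    involution; they agree, because the square of their difference is 0.
    Centrality makes fraction-free Gaussian elimination work: for a pivot [b]
    in position [(0, j)], with [c = b^* b], the matrix with entries
    [c M_ik - M_ij b^* M_0k] again consists of intertwiners, and [M D = z] with
    [z] central becomes [M' D' = c z].  By induction [c z = 0] if [M] has more
    rows than columns, and [c z X = 0] if [M X = 0]; as this holds for every
    pivot of row 0 and [z = \sum_j M_0j D_j0], the factor [c] can be dropped.
    When the center is trivial a nonzero intertwiner is invertible, so the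
    pivots met along the elimination provide the permutation and the diagonal
    entries; take [F = 1] and [E] the diagonal matrix times [M^-1]. *)

(** * Intertwiners over a ring with a proper involution *)

Section ProperInvolution.

Set Implicit Arguments.
Unset Strict Implicit.

Variables (B : pzRingType) (star : B -> B).
Hypothesis starK : involutive star.
Hypothesis starD : {morph star : a b / a + b}.
Hypothesis starM : forall a b, star (a * b) = star b * star a.
Hypothesis star_proper : forall a, star a * a = 0 -> a = 0.

Definition central (z : B) := forall x, z * x = x * z.

Definition intertwiner (f g : B -> B) (x : B) := forall b, f b * x = x * g b.

Definition star_onto (f : B -> B) :=
  {morph f : a / star a} /\ forall b, exists a, f a = b.

Lemma star_morph0 : star 0 = 0.
Proof. by apply: (addrI (star 0)); rewrite -starD !addr0. Qed.

Lemma star_morphN a : star (- a) = - star a.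
Proof. by apply: (addrI (star a)); rewrite -starD !subrr star_morph0. Qed.

Lemma central_mul y z : central y -> central z -> central (y * z).
Proof. by move=> cy cz x; rewrite -mulrA cz mulrA cy mulrA. Qed.

Lemma central_star z : central z -> central (star z).
Proof. by move=> cz x; apply: (can_inj starK); rewrite !starM starK cz. Qed.

Lemma star_cancel x y : star x * (x * y) = 0 -> x * y = 0.
Proof. by move=> xy0; apply: star_proper; rewrite starM -mulrA xy0 mulr0. Qed.

(** [star_cancel] for [z], then for [star z], leaves z z^* z y = 0; centrality moves z past z^*, and
    the hypothesis applies. *)
Lemma central_sq_cancel z y : central z -> z * (z * y) = 0 -> z * y = 0.
Proof.
move=> cz zzy0; apply: star_cancel.
by apply: star_cancel; rewrite starK mulrA cz -mulrA zzy0 mulr0.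
Qed.

Lemma intertwiner_star f g x : star_onto f -> star_onto g ->
  intertwiner f g x -> intertwiner g f (star x).
Proof.
move=> [fS _] [gS _] fgx b; apply: (can_inj starK).
by rewrite !starM starK -fS -gS fgx.
Qed.

Lemma intertwiner_mul f g h x y :
  intertwiner f g x -> intertwiner g h y -> intertwiner f h (x * y).
Proof. by move=> fgx ghy b; rewrite mulrA fgx -mulrA ghy mulrA. Qed.

Lemma intertwiner_self_central f x :
  star_onto f -> intertwiner f f x -> central x.
Proof. by move=> [_ f_onto] ffx b; have [a <-] := f_onto b; rewrite ffx. Qed.

Lemma intertwiner_starM_central f g x : star_onto f -> star_onto g ->
  intertwiner f g x -> central (star x * x).
Proof.
move=> fS gS fgx; apply: (intertwiner_self_central gS).
exact: intertwiner_mul (intertwiner_star fS gS fgx) fgx.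
Qed.

Lemma intertwiner_normal f g x : star_onto f -> star_onto g ->
  intertwiner f g x -> star x * x = x * star x.
Proof.
move=> fS gS fgx.
have cc := intertwiner_starM_central fS gS fgx.
have cd : central (x * star x).
  have := intertwiner_starM_central gS fS (intertwiner_star fS gS fgx).
  by rewrite starK.
set e := star x * x - x * star x.
have ce : central e by move=> y; rewrite mulrBl mulrBr cc cd.
have xe0 : x * e = 0.
  by rewrite /e mulrBr -[x * (x * _)]cd mulrA subrr.
have ex0 : star x * e = 0.
  by rewrite /e mulrBr -[star x * (star x * x)]cc !mulrA subrr.
apply/eqP; rewrite -subr_eq0 -/e; apply/eqP; apply: star_proper.
(* As e is self-adjoint, e^* e = e e = x^* (x e) - x (x^* e), and both terms vanish. *)
have -> : star e = e by rewrite /e starD star_morphN !starM starK.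
by rewrite {1}/e mulrBl -!mulrA xe0 ex0 !mulr0 subrr.
Qed.

(** * Fraction-free elimination on matrices of intertwiners *)

Lemma intertwiner_lcentral f g c x :
  central c -> intertwiner f g x -> intertwiner f g (c * x).
Proof. by move=> cc fgx b; rewrite mulrA -cc -mulrA fgx mulrA. Qed.

Lemma intertwinerB f g x y :
  intertwiner f g x -> intertwiner f g y -> intertwiner f g (x - y).
Proof. by move=> fgx fgy b; rewrite mulrBr mulrBl fgx fgy. Qed.

(** Since a_k^* a_k commutes with d_k, each a_k d_k z y vanishes by [star_cancel]. Summing over k
    gives z z y = 0, and one z is dropped. *)
Lemma pivots_cancel n (a d : 'I_n -> B) z y : central z ->
  (forall k, central (star (a k) * a k)) -> \sum_k a k * d k = z ->
  (forall k, star (a k) * a k * z * y = 0) -> z * y = 0.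
Proof.
move=> cz cc sumz pivot0; apply: central_sq_cancel => //.
rewrite -{1}sumz mulr_suml big1 // => k _; rewrite -mulrA; apply: star_cancel.
by rewrite mulrA [_ * (d k * _)]mulrA cc -mulrA [_ * (z * y)]mulrA pivot0 mulr0.
Qed.

(** For an invertible pivot b with c = b^* b central, this is c times the usual Schur complement,
    because c b^-1 = b^*. *)
Definition schur {m n} (M : 'M[B]_(m.+1, n.+1)) (j : 'I_n.+1) : 'M[B]_(m, n) :=
  \matrix_(i, k) (star (M ord0 j) * M ord0 j * M (lift ord0 i) (lift j k)
                  - M (lift ord0 i) j * star (M ord0 j) * M ord0 (lift j k)).

(** In M_ij b^* M_0k the factor b^* leads from the map of column j back to that of row 0, so the
    product intertwines the same pair as M_ik. *)
Lemma schur_intertwiner m n (f : 'I_m.+1 -> B -> B) (g : 'I_n.+1 -> B -> B)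
    (M : 'M[B]_(m.+1, n.+1)) (j : 'I_n.+1) :
  (forall i, star_onto (f i)) -> (forall k, star_onto (g k)) ->
  (forall i k, intertwiner (f i) (g k) (M i k)) ->
  forall (i : 'I_m) (k : 'I_n),
    intertwiner (f (lift ord0 i)) (g (lift j k)) (schur M j i k).
Proof.
move=> fS gS fgM i k; rewrite mxE; apply: intertwinerB.
  apply: intertwiner_lcentral => //.
  exact: intertwiner_starM_central (fgM _ _).
apply: intertwiner_mul (fgM _ _); apply: intertwiner_mul (fgM _ _) _.
exact: intertwiner_star (fgM _ _).
Qed.

(** By row 0, the terms M_0k X_k with k != j sum to -b X_j. The subtracted part thus contributes
    M_ij b^* b X_j = c M_ij X_j, the term missing from c times the row of M X. *)
Lemma schur_mulmx m n p (M : 'M[B]_(m.+1, n.+1)) (j : 'I_n.+1)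
    (X : 'M[B]_(n.+1, p)) i l :
  central (star (M ord0 j) * M ord0 j) -> (M *m X) ord0 l = 0 ->
  (schur M j *m row' j X) i l =
    star (M ord0 j) * M ord0 j * (M *m X) (lift ord0 i) l.
Proof.
move=> cc; rewrite !mxE !(bigD1_ord j) //= => /eqP; rewrite addrC addr_eq0.
move=> /eqP row0.
under eq_bigr => k _ do rewrite !mxE mulrBl -2!mulrA -[X in _ - X]mulrA.
rewrite sumrB -!mulr_sumr row0 mulrN opprK mulrDr addrC.
congr (_ + _); last by rewrite mulrA.
by rewrite !mulrA cc !mulrA.
Qed.

Lemma schur_right_inverse m n (M : 'M[B]_(m.+1, n.+1)) (j : 'I_n.+1)
    (D : 'M[B]_(n.+1, m.+1)) z :
  central (star (M ord0 j) * M ord0 j) -> M *m D = z%:M ->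
  schur M j *m col' ord0 (row' j D) = (star (M ord0 j) * M ord0 j * z)%:M.
Proof.
move=> cc MDz; apply/matrixP => i l.
have := @schur_mulmx _ _ _ M j D i (lift ord0 l) cc.
rewrite MDz !mxE /= (inj_eq lift_inj) mulrnAr => <- //.
by apply: eq_bigr => k _; rewrite !mxE.
Qed.

(** Induction on the number of columns; z is an arbitrary central element because each elimination
    replaces z by c z. *)
Lemma intertwiner_mx_kernel m n (f : 'I_m -> B -> B) (g : 'I_n -> B -> B)
    (M : 'M[B]_(m, n)) (D : 'M[B]_(n, m)) z :
  (forall i, star_onto (f i)) -> (forall k, star_onto (g k)) ->
  (forall i k, intertwiner (f i) (g k) (M i k)) ->
  (n <= m)%N -> central z -> M *m D = z%:M ->
  (forall X : 'cV[B]_n, M *m X = 0 -> forall k, z * X k ord0 = 0) /\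
  ((n < m)%N -> z = 0).
Proof.
elim: n m f g M D z => [|n IHn] [|m] f g M D z fS gS fgM le_nm cz MDz //.
- by split=> // X _ [].
- split=> [X _ []//|_].
  by have /matrixP/(_ ord0 ord0) := MDz; rewrite !mxE big_ord0.
have cc j : central (star (M ord0 j) * M ord0 j).
  exact: intertwiner_starM_central (fgM _ _).
have row0 : \sum_k M ord0 k * D k ord0 = z.
  by have /matrixP/(_ ord0 ord0) := MDz; rewrite !mxE.
have IH j := IHn _ _ _ _ _ _ (fun i => fS (@lift m.+1 ord0 i))
  (fun k => gS (@lift n.+1 j k)) (schur_intertwiner j fS gS fgM) le_nm
  (central_mul (cc j) cz) (schur_right_inverse (cc j) MDz).
split=> [X MX0|lt_nm]; last first.
  (* Here y = 1: the reduced matrix still has more rows than columns, so c z = 0 for every pivot. *)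
  rewrite -[z]mulr1; apply: pivots_cancel cz cc row0 _ => j.
  by have [_ ->] := IH j; rewrite ?mul0r.
have pivot0 j k : star (M ord0 j) * M ord0 j * z * X k ord0 = 0.
  set c := _ * M _ _.
  have rest0 k' : c * z * X (lift j k') ord0 = 0.
    have MX0' : schur M j *m row' j X = 0.
      apply/matrixP => i l; rewrite schur_mulmx //; last by rewrite MX0 mxE.
      by rewrite MX0 !mxE mulr0.
    by have [/(_ _ MX0' k') + _] := IH j; rewrite mxE.
  have [k' ->|->] := unliftP j k; first exact: rest0.
  (* Coordinate j remains. Row 0 expresses b X_j through the other coordinates, which c z kills; an
     extra factor c = b^* b supplies the b, and [central_sq_cancel] removes it. *)
  have /matrixP/(_ ord0 ord0) := MX0; rewrite !mxE (bigD1_ord j) //=.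
  move/eqP; rewrite addr_eq0 => /eqP bX0.
  rewrite -mulrA; apply: (central_sq_cancel (z := c)); first exact: cc.
  have -> : c * (c * (z * X j ord0)) =
            c * z * star (M ord0 j) * (M ord0 j * X j ord0).
    rewrite -[RHS]mulrA [star _ * (_ * X _ _)]mulrA -/c -[RHS]mulrA.
    congr (c * _).
    by rewrite [LHS]mulrA cc -[LHS]mulrA.
  rewrite bX0 mulrN mulr_sumr big1 ?oppr0 // => k' _.
  have ccz : central (c * z) := central_mul (cc j) cz.
  by rewrite -[LHS]mulrA ccz -2!mulrA -[X _ _ * _]ccz rest0 !mulr0.
by move=> k; apply: pivots_cancel cz cc row0 _.
Qed.

(** * Inverses and the permutation when nonzero central elements are invertible *)

Lemma intertwiner_unit f g x :
  (forall z, central z -> z != 0 -> exists2 w, central w & z * w = 1) ->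
  star_onto f -> star_onto g -> intertwiner f g x -> x != 0 ->
  exists y, x * y = 1 /\ y * x = 1.
Proof.
move=> center_inv fS gS fgx x_neq0.
have [||w cw w_inv] := center_inv (star x * x).
- exact: intertwiner_starM_central fgx.
- by apply: contraNneq x_neq0 => /star_proper ->.
(* w inverts x^* x, which equals x x^*, so x^* w inverts x on both sides. *)
exists (star x * w); split.
  by rewrite mulrA -(intertwiner_normal fS gS fgx).
by rewrite -cw -mulrA cw.
Qed.

(** Each [d i] is a pivot, in general an entry of an iterated [schur] matrix rather than of [M]. Row
    0 has a nonzero entry because z != 0, and c z stays nonzero because c is invertible. *)
Lemma intertwiner_permutation n (f g : 'I_n -> B -> B) (M D : 'M[B]_n) z :
  (forall z, central z -> z != 0 -> exists2 w, central w & z * w = 1) ->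
  (forall i, star_onto (f i)) -> (forall k, star_onto (g k)) ->
  (forall i k, intertwiner (f i) (g k) (M i k)) ->
  central z -> z != 0 -> M *m D = z%:M ->
  exists (s : 'S_n) (d : 'I_n -> B), forall i,
    intertwiner (f i) (g (s i)) (d i) /\ d i != 0.
Proof.
move=> center_inv.
elim: n f g M D z => [|n IHn] f g M D z fS gS fgM cz z_neq0 MDz.
  by exists 1%g, (fun=> 0) => -[].
have [j Mj_neq0] : exists j, M ord0 j != 0.
  apply/existsP; apply: contra_neqT z_neq0 => /existsPn row0.
  have /matrixP/(_ ord0 ord0) := MDz; rewrite !mxE eqxx mulr1n => <-.
  by rewrite big1 // => k _; rewrite (eqP (negPn (row0 k))) mul0r.
set c := star (M ord0 j) * M ord0 j.
have cc : central c by apply: intertwiner_starM_central (fgM _ _).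
have c_neq0 : c != 0 by apply: contraNneq Mj_neq0 => /star_proper ->.
have cz_neq0 : c * z != 0.
  have [w _ cw1] := center_inv _ cc c_neq0.
  apply: contraNneq z_neq0 => cz0.
  by rewrite -[z]mul1r -cw1 cc -mulrA cz0 mulr0.
have [s [d sd]] := IHn _ _ _ _ _ (fun i => fS (@lift n.+1 ord0 i))
  (fun k => gS (@lift n.+1 j k)) (schur_intertwiner j fS gS fgM)
  (central_mul cc cz) cz_neq0 (schur_right_inverse cc MDz).
(* Row 0 goes to the pivot column j; the other rows follow s on the matrix with row 0 and column j
   deleted. *)
exists (lift_perm ord0 j s), (fun i => oapp d (M ord0 j) (unlift ord0 i)) => i.
have [i' ->|->] := unliftP ord0 i; last by rewrite lift_perm_id.
by rewrite lift_perm_lift.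
Qed.

End ProperInvolution.

(** With z = 1 the kernel of M is trivial, and it contains every column of D M - 1. Having n < m
    would force 1 = 0, impossible in a nonzero ring. *)
Lemma right_invertible_intertwiner_mx (B : nzRingType) (star : B -> B) m n
    (f : 'I_m -> B -> B) (g : 'I_n -> B -> B) (M : 'M[B]_(m, n))
    (D : 'M[B]_(n, m)) :
  involutive star -> (forall a b, star (a * b) = star b * star a) ->
  (forall a, star a * a = 0 -> a = 0) ->
  (forall i, star_onto star (f i)) -> (forall k, star_onto star (g k)) ->
  (forall i k, intertwiner (f i) (g k) (M i k)) ->
  (n <= m)%N -> M *m D = 1%:M -> m = n /\ D *m M = 1%:M.
Proof.
move=> starK starM star_proper fS gS fgM le_nm MD1.
have c1 : central (1 : B) by move=> x; rewrite mulr1 mul1r.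
have [ker0 lt0] :=
  intertwiner_mx_kernel starK starM star_proper fS gS fgM le_nm c1 MD1.
split.
  apply/eqP; rewrite eqn_leq le_nm andbT leqNgt; apply/negP => /lt0/eqP.
  by rewrite oner_eq0.
apply/eqP; rewrite -subr_eq0; apply/eqP/matrixP => k l.
have /ker0/(_ k) : M *m col l (D *m M - 1%:M) = 0.
  by rewrite colE mulmxA mulmxBr mulmxA MD1 mul1mx mulmx1 subrr mul0mx.
by rewrite mul1r !mxE.
Qed.

(** * C*-algebras: properness of the involution and scalar center *)

Section CStar.

Variables (R : realType) (B : algType R[i]) (star : B -> B) (nrm : B -> R).
Hypothesis cstar : is_unital_cstar star nrm.

(** By the C*-identity the squared norm of a is the norm of 0, which vanishes by homogeneity with
    scalar 0. *)
Lemma cstar_proper a : star a * a = 0 -> a = 0.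
Proof.
case: cstar => _ [[_ [nrm0_eq0 [_ [nrmZ [_ nrm_star]]]]] _] saa0.
apply: nrm0_eq0; apply/eqP; rewrite -sqrf_eq0 -nrm_star saa0.
by rewrite -(scale0r 0) nrmZ /cmod /= expr0n addr0 sqrtr0 mul0r.
Qed.

Lemma star_epi_onto f : star_epi star f -> star_onto star f.
Proof. by case. Qed.

Lemma trivial_center_inv : trivial_center B ->
  forall z : B, central z -> z != 0 -> exists2 w, central w & z * w = 1.
Proof.
move=> triv z /triv[c ->] c_neq0.
have {}c_neq0 : c != 0 by apply: contraNneq c_neq0 => ->; rewrite scale0r.
exists (c^-1)%:A; last by rewrite -scalerAl mul1r scalerA divff ?scale1r.
by move=> x; rewrite -scalerAl -scalerAr mul1r mulr1.
Qed.

End CStar.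

Theorem theorem3p4 (R : realType) (B : algType R[i]) (star : B -> B)
  (nrm : B -> R) (m n : nat)
  (beta : 'I_m -> B -> B) (beta' : 'I_n -> B -> B) (M : 'M[B]_(m, n)) :
  is_unital_cstar star nrm ->
  (forall i, star_epi star (beta i)) ->
  (forall j, star_epi star (beta' j)) ->
  (n <= m)%N ->
  (forall (b : B) (i : 'I_m) (j : 'I_n), beta i b * M i j = M i j * beta' j b) ->
  right_invertible M ->
  (* (i) *)
  (m = n /\ exists D : 'M[B]_(n, m), M *m D = 1%:M /\ D *m M = 1%:M) /\
  (* (ii) *)
  (trivial_center B ->
   exists (E : 'M[B]_m) (F : 'M[B]_n) (pi : 'I_m -> 'I_n),
     [/\ invertible_mx E, invertible_mx F, bijective pi,
         (forall (i : 'I_m) (j : 'I_n), (i : nat) <> j -> (E *m M *m F) i j = 0) &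
         (forall (b : B) (i : 'I_m) (j : 'I_n), (i : nat) = j ->
            beta i b * (E *m M *m F) i j = (E *m M *m F) i j * beta' (pi i) b)]).
Proof.
move=> cstar beta_epi beta'_epi le_nm interM [D MD1].
have [[starK [starD [_ starM]]] _] := cstar.
have star_proper := cstar_proper cstar.
have betaS i := star_epi_onto (beta_epi i).
have beta'S j := star_epi_onto (beta'_epi j).
have intM i j : intertwiner (beta i) (beta' j) (M i j) by move=> b.
have [eq_mn DM1] := right_invertible_intertwiner_mx starK starM
  star_proper betaS beta'S intM le_nm MD1.
split=> [|triv]; first by split=> //; exists D.
subst n.
have center_inv := trivial_center_inv triv.
have c1 : central (1 : B) by move=> x; rewrite mulr1 mul1r.
have [s [d sd]] := intertwiner_permutation starK starM star_proper
  center_inv betaS beta'S intM c1 (oner_neq0 _) MD1.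
have /fin_all_exists[e de] i : exists y, d i * y = 1 /\ y * d i = 1.
  have [intd d_neq0] := sd i.
  exact: (intertwiner_unit starK starD starM star_proper center_inv)
    intd d_neq0.
pose dg (u : 'I_m -> B) := diag_mx (\row_i u i).
have dgM u v : (forall i, u i * v i = 1) -> dg u *m dg v = 1%:M.
  move=> uv1; rewrite /dg mulmx_diag; apply/matrixP => i j.
  by rewrite !mxE uv1.
(* D is a left inverse of M, so multiplying by [dg d *m D] leaves exactly the diagonal of pivots. *)
have EMF : dg d *m D *m M *m 1%:M = dg d.
  by rewrite mulmx1 -mulmxA DM1 mulmx1.
exists (dg d *m D), 1%:M, s; split.
(* Both factors of E are invertible, with inverses M and the diagonal of the [e i], taken in reverse
   order. *)
- exists (M *m dg e); split.
    by rewrite mulmxA -[_ *m D *m M]mulmxA DM1 mulmx1 dgM // => i; case: (de i).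
  rewrite mulmxA -[_ *m dg e *m _]mulmxA dgM ?mulmx1 // => i.
  by case: (de i).
- by exists 1%:M; rewrite mulmx1.
- by exists (s^-1)%g; [exact: permK | exact: permKV].
- move=> i j neq_ij; rewrite EMF !mxE; case: eqP => // eq_ij.
  by case: neq_ij; rewrite eq_ij.
- move=> b i j /val_inj <-; rewrite EMF !mxE eqxx.
  by have [-> _] := sd i.
Qed.
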